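(* Let $t,q,\kappa$ be nonzero constants. Let $P_n(z)$, $n\in\mathbb{N}$, be the Laurent biorthogonal polynomials determined by $$P_{n+1}(z) = (z - c_n) P_n(z) - b_n z P_{n-1}(z)\quad (n\ge 1),\qquad P_0(z)=1,\quad P_1(z)=z-c_0,$$ with the coefficients $$b_n = q^{2n-1}\ (n\ge 1),\qquad c_n = t q^{2n}\ (n\ge 0).$$ Then the linear functional $\mathcal{F}$ for $P_n(z)$, normalized by $\mathcal{F}[z]=\kappa$, has moments $f_k=\mathcal{F}[z^k]$ described by the $q$-Narayana polynomials: $$f_k = \kappa\, N_{k-1}(t,q) \quad\text{for } k\ge 1,\qquad f_k = \kappa\, t^{-2|k|-1} N_{|k|}(t,q^{-1})\quad\text{for } k\le 0.$$
   Context: $\mathbb{N}=\{0,1,2,\ldots\}$. For nonzero constants $b_n$ ($n\ge1$), $c_n$ ($n\ge 0$), the polynomials $P_n(z)$ defined by the recurrence are called (monic) Laurent biorthogonal polynomials. There is a linear functional $\mathcal{F}$ on Laurent polynomials in $z$, unique up to a constant factor, such that $\mathcal{F}[P_n(z)z^{-k}]=h_n\delta_{n,k}$ for $0\le k\le n$ with some constants $h_n\ne 0$; this is ''the linear functional for $P_n(z)$'', and it is fixed by prescribing $\mathcal{F}[z]=\kappa$ with $\kappa\neq0$. A Schröder path is a lattice path in $\mathbb{Z}^2$ consisting of up steps $(1,1)$, down steps $(1,-1)$ and level steps $(2,0)$, never going beneath the $x$-axis (the path without steps is allowed). $S_k$ is the set of Schröder paths from $(0,0)$ to $(2k,0)$.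 $\mathrm{level}(P)$ is the number of level steps of $P$ and $\mathrm{area}(P)$ is the area of the region between $P$ and the $x$-axis. The $q$-Narayana polynomials are $N_k(t,q)=\sum_{P\in S_k} t^{\mathrm{level}(P)} q^{\mathrm{area}(P)}$, $k\in\mathbb{N}$. *)

(* Defs.v *)
From HB Require Import structures.
From mathcomp Require Import all_boot all_order all_algebra.
From mathcomp Require Import monalg.
From mathcomp Require Import zify.

Set Implicit Arguments.
Unset Strict Implicit.
Unset Printing Implicit Defensive.

Import Order.TTheory GRing.Theory Num.Theory.
Local Open Scope ring_scope.

(** The Laurent polynomials K[z, z^-1], as the free K-module on the monomials
    z^k, k : int.  (The library's product on {malg _[_]} requires exponents in
    a monoid without nontrivial units, so it does not apply to int; the only
    products needed here are given by [polyMz].) *)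
Definition laurent (K : fieldType) : lmodType K := {malg K[int]}.

Definition zpow (K : fieldType) (k : int) : laurent K := << 1 *g k >>.

(** The Laurent polynomial p(z) z^m. *)
Definition polyMz (K : fieldType) (p : {poly K}) (m : int) : laurent K :=
  \sum_(i < size p) p`_i *: zpow K (i%:Z + m).

Definition laurent_biorthogonal (K : fieldType) (b c : nat -> K)
    (P : nat -> {poly K}) : Prop :=
  [/\ P 0%N = 1,
      P 1%N = 'X - (c 0%N)%:P
    & forall n : nat, (1 <= n)%N ->
        P n.+1 = ('X - (c n)%:P) * P n - (b n)%:P * 'X * P n.-1].

(** [*+ (n == k)] is the factor delta_{n,k}. *)
Definition functional_for (K : fieldType) (P : nat -> {poly K})
    (F : {scalar laurent K}) : Prop :=
  exists h : nat -> K,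
    (forall n : nat, h n != 0) /\
    (forall n k : nat, (k <= n)%N ->
       F (polyMz (P n) (- k%:Z)) = h n *+ (n == k)).

Inductive step : predArgType := Up | Down | Level.

Definition step_code (s : step) : option bool :=
  match s with Up => Some true | Down => Some false | Level => None end.

Definition step_decode (o : option bool) : step :=
  match o with Some true => Up | Some false => Down | None => Level end.

Lemma step_codeK : cancel step_code step_decode.
Proof. by case. Qed.

HB.instance Definition _ := Finite.copy step (can_type step_codeK).

Definition step_vec (s : step) : int * int :=
  match s with Up => (1, 1) | Down => (1, -1) | Level => (2, 0) end.

(** The lattice points visited by the path with steps [s] issued from [p]. *)
Definition path_points (p : int * int) (s : seq step) : seq (int * int) :=
  p :: scanl (fun x a => x + step_vec a) p s.

Definition schroder_path (k : nat) (s : seq step) : bool :=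
  all (fun p => 0 <= p.2) (path_points (0, 0) s)
    && (last (0, 0) (path_points (0, 0) s) == ((2 * k)%:Z, 0)).

(** Twice the area between the x-axis and the path with steps [s] issued from
    height [y]: each step (dx, dy) contributes a trapezoid with parallel sides
    y and y + dy and width dx. *)
Fixpoint double_area (y : int) (s : seq step) : int :=
  if s is a :: s' then
    (step_vec a).1 * (y + (y + (step_vec a).2))
      + double_area (y + (step_vec a).2) s'
  else 0.

(** For Schröder paths the division is exact and the absolute value is
    superfluous; see [areaE]. *)
Definition area (s : seq step) : nat := `|(double_area 0 s %/ 2)%Z|%N.

Definition level (s : seq step) : nat := count_mem Level s.

(** S_k; the bound on the number of steps excludes no path, see
    [schroder_path_size]. *)
Definition schroder (k : nat) : {set {bseq (2 * k) of step}} :=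
  [set s : {bseq (2 * k) of step} | schroder_path k s].

Definition narayana (K : fieldType) (k : nat) (t q : K) : K :=
  \sum_(s in schroder k) t ^+ level s * q ^+ area s.

Lemma path_points_cons p a s :
  path_points p (a :: s) = p :: path_points (p + step_vec a) s.
Proof. by []. Qed.

Lemma last_path_points p0 p a s :
  last p0 (path_points p (a :: s)) = last p0 (path_points (p + step_vec a) s).
Proof. by []. Qed.

Lemma double_area_ge0 p s : all (fun p => 0 <= p.2) (path_points p s) ->
  0 <= double_area p.2 s.
Proof.
elim: s p => [//|a s IHs] p; rewrite path_points_cons [all _ _]/= => /andP[p0 Hs].
have := IHs _ Hs; move: Hs => /= /andP[+ _].
by case: a => /=; lia.
Qed.

Lemma double_area_even p s : exists m : int,
  double_area p.2 s = (last (0, 0) (path_points p s)).2 - p.2 + 2 * m.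
Proof.
elim: s p => [|a s IHs] p; first by exists 0 => /=; lia.
have [m] := IHs (p + step_vec a); rewrite last_path_points => Hm.
exists (m + match a with Up => p.2 | Down => p.2 | Level => 2 * p.2 end).
by move: Hm; case: a => /= ->; lia.
Qed.

Lemma areaE k s : schroder_path k s -> (area s)%:Z * 2 = double_area 0 s.
Proof.
case/andP=> /double_area_ge0 ge0 /eqP lst.
by have [m] := double_area_even (0, 0) s; rewrite lst /area; move: ge0 => /=; lia.
Qed.

Lemma path_points_size p s :
  (size s)%:Z <= (last (0, 0) (path_points p s)).1 - p.1.
Proof.
elim: s p => [|a s IHs] p; first by rewrite /= subrr.
by have := IHs (p + step_vec a); rewrite last_path_points; case: a => /=; lia.
Qed.

Lemma schroder_path_size k s : schroder_path k s -> (size s <= 2 * k)%N.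
Proof.
by case/andP=> _ /eqP lst; have := path_points_size (0, 0) s; rewrite lst /=; lia.
Qed.

(* Main.v *)
Require Import Defs.
From mathcomp Require Import all_boot all_order all_algebra.
From mathcomp Require Import zify ring.

Set Implicit Arguments.
Unset Strict Implicit.
Unset Printing Implicit Defensive.

Import Order.TTheory GRing.Theory Num.Theory.
Local Open Scope ring_scope.

(** Put A(n, k) = F[P_n(z) z^k].  The three-term recurrence reads
      A(n, k+1) = A(n+1, k) + c_n A(n, k) + b_n A(n-1, k+1),
    and biorthogonality gives A(n, 0) = 0 for n >= 1.  Unfolding it, A(n, k+1)
    is F[z] times the sum over the lattice paths from height n to height 0 with
    k up or level steps, where a down step from height n weighs b_n, a level
    step at height n weighs c_n and an up step weighs 1; for n = 0 these are
    the Schröder paths in S_k.  The exponent e of q in the weight of a path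
    from height n satisfies 2 e = 2 area + n^2, by telescoping of the squared
    heights.
    For the nonpositive moments,
      D(n, k) = F[P_n(z) z^(1-n-k)] / ((-c_0) ... (-c_(n-1)))
    obeys the same recurrence and boundary condition, with c_n and b_n replaced
    by 1 / c_n and b_n / (c_n c_(n-1)); these are the coefficients of the
    reversed polynomials z^n P_n(1/z) / P_n(0). *)

(** * Enumeration of lattice paths by their up and level steps *)

Section LatticePaths.

(** The lattice paths from height [n] to height 0 with [k] up or level steps. *)
Fixpoint paths (k : nat) : nat -> seq (seq step) :=
  if k is k'.+1 then
    fix paths_k n :=
      [seq Up :: s | s <- paths k' n.+1] ++ [seq Level :: s | s <- paths k' n]
        ++ (if n is n'.+1 then [seq Down :: s | s <- paths_k n'] else [::])
  else fun n => [:: nseq n Down].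

Lemma pathsS0 k :
  paths k.+1 0 = [seq Up :: s | s <- paths k 1]
                   ++ [seq Level :: s | s <- paths k 0] ++ [::].
Proof. by []. Qed.

Lemma pathsSS k n :
  paths k.+1 n.+1 = [seq Up :: s | s <- paths k n.+2]
                      ++ [seq Level :: s | s <- paths k n.+1]
                      ++ [seq Down :: s | s <- paths k.+1 n].
Proof. by []. Qed.

Lemma mem_map_cons (a b : step) s (r : seq (seq step)) :
  (a :: s \in [seq b :: s | s <- r]) = (a == b) && (s \in r).
Proof.
apply/mapP/andP => [[s' s'r [-> ->]]|[/eqP-> sr]]; first by rewrite eqxx.
by exists s.
Qed.

Lemma nil_map_cons (b : step) (r : seq (seq step)) :
  ([::] \in [seq b :: s | s <- r]) = false.
Proof. by apply/mapP => -[]. Qed.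

(** The blocks of [paths] differ in the first step. Uniqueness turns a sum over this list into a sum
    over a set of paths. *)
Lemma uniq_paths k n : uniq (paths k n).
Proof.
have consI (a : step) : injective (cons a) by move=> s1 s2 [].
have disj (a b : step) r1 r2 : a != b ->
    ~~ has (mem [seq a :: s | s <- r1]) [seq b :: s | s <- r2].
  move=> ab; apply/hasPn => _ /mapP[s _ ->] /=.
  by rewrite mem_map_cons eq_sym (negPf ab).
elim: k n => [//|k IHk] n; elim: n => [|n IHn].
  by rewrite pathsS0 cats0 cat_uniq !map_inj_uniq ?IHk ?disj.
rewrite pathsSS !cat_uniq !map_inj_uniq ?IHk ?IHn //= has_cat negb_or.
by rewrite !disj.
Qed.

Lemma path_points_advance (p : int * int) s :
  p.1 + p.2 <= (last (0, 0) (path_points p s)).1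
               + (last (0, 0) (path_points p s)).2.
Proof.
elim: s p => [//|a s IHs] p; have := IHs (p + step_vec a).
by rewrite last_path_points; case: a => /=; lia.
Qed.

(** Up and level steps raise x + y by 2 and down steps preserve it, so the end point (x + n + 2k, 0)
    forces exactly k up or level steps. The abscissa x is left free for the induction on [s]. *)
Lemma mem_paths k n x s :
  (s \in paths k n)
  = all (fun p => 0 <= p.2) (path_points (x, n%:Z) s)
    && (last (0, 0) (path_points (x, n%:Z) s) == (x + (n + 2 * k)%:Z, 0)).
Proof.
elim: s k n x => [|a s IHs] k n x.
  have -> : ([::] \in paths k n) = (k == 0%N) && (n == 0%N).
    case: k => [|k]; case: n => [|n] //.
      by rewrite pathsS0 !mem_cat !nil_map_cons.
    by rewrite pathsSS !mem_cat !nil_map_cons.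
  rewrite /= !xpair_eqE; lia.
have IHs' y m k' : all (fun p => 0 <= p.2) (path_points (y, m%:Z) s)
    && (last (0, 0) (path_points (y, m%:Z) s) == (y + (m + 2 * k')%:Z, 0))
    = (s \in paths k' m) by rewrite -IHs.
(* Used for k = 0, where a first up or level step already pushes x + y past its final value. *)
have short (y m z : int) : z < y + m ->
    (last (0, 0) (path_points (y, m) s) == (z, 0)) = false.
  move=> lt_z; apply/eqP => lst.
  by have := path_points_advance (y, m) s; rewrite lst /=; lia.
have up : (x, n%:Z) + step_vec Up = (x + 1, n.+1%:Z).
  by congr pair => /=; lia.
have level : (x, n%:Z) + step_vec Level = (x + 2, n%:Z).
  by congr pair => /=; lia.
have down m : (x, m.+1%:Z) + step_vec Down = (x + 1, m%:Z).
  by congr pair => /=; lia.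
rewrite last_path_points.
have -> : all (fun p => 0 <= p.2) (path_points (x, n%:Z) (a :: s))
          = all (fun p => 0 <= p.2) (path_points ((x, n%:Z) + step_vec a) s).
  by [].
case: a.
- rewrite up; case: k => [|k].
    rewrite short ?andbF; last lia.
    by case: n {up level}.
  rewrite (_ : x + (n + 2 * k.+1)%:Z = x + 1 + (n.+1 + 2 * k)%:Z); last lia.
  rewrite IHs'; case: n {up level} => [|n].
    by rewrite pathsS0 !mem_cat !mem_map_cons /= !orbF.
  by rewrite pathsSS !mem_cat !mem_map_cons /= !orbF.
- case: n {up level} => [|n].
    (* A down step from the axis reaches height -1. *)
    have -> : all (fun p => 0 <= p.2) (path_points ((x, 0%:Z) + step_vec Down) s)
              = false by [].
    case: k => [//|k].
    by rewrite pathsS0 !mem_cat !mem_map_cons.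
  rewrite down (_ : x + (n.+1 + 2 * k)%:Z = x + 1 + (n + 2 * k)%:Z); last lia.
  rewrite IHs'; case: k => [|k].
    by rewrite !inE eqseq_cons.
  by rewrite pathsSS !mem_cat !mem_map_cons.
- rewrite level; case: k => [|k].
    rewrite short ?andbF; last lia.
    by case: n {up level}.
  rewrite (_ : x + (n + 2 * k.+1)%:Z = x + 2 + (n + 2 * k)%:Z); last lia.
  rewrite IHs'; case: n {up level} => [|n].
    by rewrite pathsS0 !mem_cat !mem_map_cons /= !orbF.
  by rewrite pathsSS !mem_cat !mem_map_cons /= !orbF.
Qed.

Lemma mem_paths0 k s : (s \in paths k 0) = schroder_path k s.
Proof. by rewrite (mem_paths k 0 0) add0n add0r. Qed.

Lemma narayanaE (K : fieldType) k (t q : K) :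
  narayana k t q = \sum_(s <- paths k 0) t ^+ level s * q ^+ area s.
Proof.
rewrite /narayana -big_enum /=.
rewrite -(big_map val predT (fun s : seq step => t ^+ level s * q ^+ area s)).
apply/perm_big/uniq_perm; last move=> s.
- by rewrite (map_inj_uniq val_inj) enum_uniq.
- exact: uniq_paths.
rewrite mem_paths0; apply/mapP/idP => [[s' + ->]|sk].
  by rewrite mem_enum inE.
by exists (Bseq (schroder_path_size sk)); rewrite // mem_enum inE.
Qed.

End LatticePaths.

(** * Path weights and their powers of q *)

Section WeightedPaths.

Variables (K : fieldType) (b c : nat -> K).

Fixpoint weight (n : nat) (s : seq step) : K :=
  match s with
  | [::] => 1
  | Up :: s' => weight n.+1 s'
  | Down :: s' => b n * weight n.-1 s'
  | Level :: s' => c n * weight n s'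
  end.

(** The induction is lexicographic in (k, n): up and level steps lower k, while a down step keeps k
    and lowers n. For k = 0 the boundary condition leaves only the straight descent. *)
Lemma path_recurrence (A : nat -> nat -> K) :
  (forall n, A n.+1 0 = 0) ->
  (forall k, A 0 k.+1 = A 1 k + c 0 * A 0 k) ->
  (forall n k,
     A n.+1 k.+1 = A n.+2 k + c n.+1 * A n.+1 k + b n.+1 * A n k.+1) ->
  forall n k, A n k.+1 = A 0 1 * \sum_(s <- paths k n) weight n s.
Proof.
move=> A0 A0S ASS n k; elim: k n => [|k IHk] n; elim: n => [|n IHn].
- by rewrite big_seq1 mulr1.
- by rewrite ASS !A0 IHn !big_seq1 /=; ring.
- rewrite A0S !IHk pathsS0 !big_cat !big_map big_nil /=.
  by rewrite -mulr_sumr; ring.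
rewrite ASS !IHk IHn pathsSS !big_cat !big_map /=.
by rewrite -!mulr_sumr; ring.
Qed.

(** Down steps outnumber up steps by n, so there are n + k down or level steps; each contributes one
    factor u. *)
Definition qpower (u v q : K) (k n : nat) (s : seq step) : Prop :=
  exists2 e : nat, (2 * e)%:Z = double_area n s + (n ^ 2)%:Z
    & weight n s = u ^+ (n + k) * v ^+ level s * q ^+ e.

Lemma weight_qpower (u v q : K) :
  (forall n, b n.+1 = u * q ^+ (2 * n + 1)) ->
  (forall n, c n = u * v * q ^+ (2 * n)) ->
  forall k n s, s \in paths k n -> qpower u v q k n s.
Proof.
move=> bE cE.
have up k n s : qpower u v q k n.+1 s -> qpower u v q k.+1 n (Up :: s).
  case=> e eE wE; exists e; last by rewrite /= wE addSnnS.
  by rewrite /= (_ : n%:Z + 1 = n.+1%:Z); lia.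
have level k n s : qpower u v q k n s -> qpower u v q k.+1 n (Level :: s).
  case=> e eE wE; exists (e + 2 * n)%N; first by rewrite /= addr0; lia.
  by rewrite /= wE cE /level /= addnS !exprS !exprD; ring.
have down k n s : qpower u v q k n s -> qpower u v q k n.+1 (Down :: s).
  case=> e eE wE; exists (e + (2 * n + 1))%N.
    by rewrite /= (_ : n.+1%:Z - 1 = n%:Z); lia.
  by rewrite /= wE bE /level /= !exprS !exprD; ring.
elim=> [|k IHk] n; elim: n => [|n IHn] s.
- by rewrite inE => /eqP->; exists 0%N; rewrite ?expr0 ?mulr1.
- by rewrite inE => /eqP->; apply/down/IHn; rewrite inE.
- rewrite pathsS0 cats0 mem_cat => /orP[] /mapP[s' s'P ->].
    exact/up/IHk.
  exact/level/IHk.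
rewrite pathsSS !mem_cat => /or3P[] /mapP[s' s'P ->].
- exact/up/IHk.
- exact/level/IHk.
exact/down/IHn.
Qed.

Lemma sum_weight_narayana (u v q : K) :
  (forall n, b n.+1 = u * q ^+ (2 * n + 1)) ->
  (forall n, c n = u * v * q ^+ (2 * n)) ->
  forall k, \sum_(s <- paths k 0) weight 0 s = u ^+ k * narayana k v q.
Proof.
move=> bE cE k; rewrite narayanaE mulr_sumr !big_seq; apply: eq_bigr => s sk.
have [e eE ->] := weight_qpower bE cE sk.
rewrite add0n mulrA; congr (_ * q ^+ _).
have aE : (area s)%:Z * 2 = double_area 0%N s.
  by apply: (@areaE k); rewrite -mem_paths0.
by rewrite -aE in eE; lia.
Qed.

End WeightedPaths.

(** * From the three-term recurrence to the moments *)

Section Moments.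

Variable K : fieldType.

Lemma polyMz_widen (p : {poly K}) m N : (size p <= N)%N ->
  polyMz p m = \sum_(i < N) p`_i *: zpow K (i%:Z + m).
Proof.
move=> le_pN; rewrite /polyMz.
rewrite (big_ord_widen N (fun i => p`_i *: zpow K (i%:Z + m)) le_pN).
rewrite big_mkcond; apply: eq_bigr => i _; case: ifPn => //.
by rewrite -leqNgt => le_pi; rewrite nth_default ?scale0r.
Qed.

Lemma polyMzP a (p r : {poly K}) m :
  polyMz (a *: p + r) m = a *: polyMz p m + polyMz r m.
Proof.
pose N := maxn (size (a *: p + r)) (maxn (size p) (size r)).
rewrite !(@polyMz_widen _ _ N) ?leq_max ?leqnn ?orbT //.
rewrite scaler_sumr -big_split; apply: eq_bigr => i _.
by rewrite coefD coefZ scalerDl scalerA.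
Qed.

Lemma polyMz_mulX (p : {poly K}) m : polyMz ('X * p) m = polyMz p (m + 1).
Proof.
rewrite (@polyMz_widen _ _ (size p).+1); last first.
  by rewrite mulrC (leq_trans (size_polyMleq _ _)) ?size_polyX ?addn2.
rewrite big_ord_recl coefXM scale0r add0r; apply: eq_bigr => i _.
by rewrite lift0 coefXM; congr (_ *: zpow K _); lia.
Qed.

Lemma polyMz1 m : polyMz (1 : {poly K}) m = zpow K m.
Proof. by rewrite /polyMz size_poly1 big_ord1 coef1 scale1r add0r. Qed.

Variables (b c : nat -> K) (P : nat -> {poly K}) (F : {scalar laurent K}).
Hypothesis hP : laurent_biorthogonal b c P.
Hypothesis hF : functional_for P F.

Let A n m := F (polyMz (P n) m).

Lemma moment0 m : A 0 m = F (zpow K m).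
Proof. by case: hP => P0 _ _; rewrite /A P0 polyMz1. Qed.

Lemma moment_recl0 m : A 1 m = A 0 (m + 1) - c 0 * A 0 m.
Proof.
case: hP => P0 P1 _; rewrite /A P1 P0.
rewrite (_ : _ - _ = - c 0%N *: 1 + 'X * 1); last first.
  by rewrite -mul_polyC polyCN; ring.
by rewrite polyMzP polyMz_mulX linearP; ring.
Qed.

Lemma moment_rec n m :
  A n.+2 m = A n.+1 (m + 1) - c n.+1 * A n.+1 m - b n.+1 * A n (m + 1).
Proof.
case: hP => _ _ PS; rewrite /A PS //=.
rewrite (_ : _ - _ = - c n.+1 *: P n.+1
                     + (- b n.+1 *: ('X * P n) + 'X * P n.+1)); last first.
  by rewrite -!mul_polyC !polyCN; ring.
by rewrite !polyMzP !polyMz_mulX !linearP; ring.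
Qed.

Lemma biorthogonal_eq0 n k : (k < n)%N -> A n (- k%:Z) = 0.
Proof.
case: hF => h [_ hE] lt_kn.
by rewrite /A hE ?(ltnW lt_kn) // gtn_eqF.
Qed.

Lemma moment_pos k :
  F (zpow K k.+1%:Z)
  = F (zpow K 1) * \sum_(s <- paths k 0) weight b c 0 s.
Proof.
rewrite -[F (zpow K k.+1%:Z)]moment0 -[F (zpow K 1)]moment0.
apply: (@path_recurrence _ b c (fun n k => A n k%:Z)) => [n|j|n j].
- exact: (@biorthogonal_eq0 _ 0).
- by rewrite moment_recl0 -[j.+1]addn1 PoszD; ring.
by rewrite moment_rec -[j.+1]addn1 PoszD; ring.
Qed.

Hypothesis c_neq0 : forall n, c n != 0.

Lemma moment_neg k :
  F (zpow K (- k%:Z))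
  = F (zpow K 0)
    * \sum_(s <- paths k 0)
        weight (fun n => b n / (c n * c n.-1)) (fun n => (c n)^-1) 0 s.
Proof.
(* This is P_n(0), since at z = 0 the recurrence reduces to the factor -c_n. *)
pose d n := \prod_(i < n) - c i.
have dS n : d n.+1 = - (d n * c n) by rewrite /d big_ord_recr /= mulrN.
have d_neq0 n : d n != 0 by apply/prodf_neq0 => i _; rewrite oppr_eq0.
pose D n k := A n (1 - n%:Z - k%:Z) / d n.
have AD n j m : m = 1 - n%:Z - j%:Z -> A n m = D n j * d n.
  by move=> ->; rewrite divfK.
(* The shift by one puts F[1] at D(0, 1), the entry that [path_recurrence] factors out. *)
have D0 j : D 0 j.+1 = F (zpow K (- j%:Z)).
  by rewrite /D /d big_ord0 divr1 moment0; congr (F (zpow K _)); lia.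
rewrite -[F (zpow K (- _))]D0 -[F (zpow K 0)](D0 0%N).
apply: path_recurrence => [n|j|n j].
(* D(n+1, 0) is a multiple of F[P_(n+1)(z) z^(-n)], which biorthogonality kills. *)
- rewrite /D (_ : 1 - _ - _ = - n%:Z); last lia.
  by rewrite biorthogonal_eq0 ?mul0r.
- have -> : D 1%N j = (D 0%N j * d 0%N - c 0%N * (D 0%N j.+1 * d 0%N)) / d 1%N.
    rewrite -(AD 0%N j (- j%:Z + 1)); last lia.
    rewrite -(AD 0%N j.+1 (- j%:Z)); last lia.
    by rewrite -moment_recl0; congr (A _ _ / _); lia.
  by rewrite dS; field; rewrite c_neq0 -dS d_neq0.
(* This is [moment_rec] at exponent -n-j-2+1. Solving it for D(n+1, j+1) divides by c_(n+1), which
   produces the reciprocal weights. *)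
have -> : D n.+2 j = (D n.+1 j * d n.+1 - c n.+1 * (D n.+1 j.+1 * d n.+1)
                      - b n.+1 * (D n j.+1 * d n)) / d n.+2.
  rewrite -(AD n.+1 j (- n%:Z - j%:Z - 1 + 1)); last lia.
  rewrite -(AD n.+1 j.+1 (- n%:Z - j%:Z - 1)); last lia.
  rewrite -(AD n j.+1 (- n%:Z - j%:Z - 1 + 1)); last lia.
  by rewrite -moment_rec; congr (A _ _ / _); lia.
by rewrite !dS /=; field; rewrite -!dS !c_neq0 !d_neq0.
Qed.

End Moments.

Theorem theorem7 (K : fieldType) (t q kappa : K)
    (ht : t != 0) (hq : q != 0) (hkappa : kappa != 0)
    (b c : nat -> K)
    (hb : forall n : nat, (1 <= n)%N -> b n = q ^+ (2 * n - 1))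
    (hc : forall n : nat, c n = t * q ^+ (2 * n))
    (P : nat -> {poly K}) (hP : laurent_biorthogonal b c P)
    (F : {scalar laurent K}) (hF : functional_for P F)
    (hFz : F (zpow K 1) = kappa) :
  (forall k : int, 1 <= k ->
     F (zpow K k) = kappa * narayana `|k - 1|%N t q) /\
  (forall k : int, k <= 0 ->
     F (zpow K k) = kappa * t ^ (- 2 * `|k| - 1) * narayana `|k|%N t q^-1).
Proof.
have c_neq0 n : c n != 0 by rewrite hc mulf_neq0 ?expf_neq0.
have bE n : b n.+1 = q ^+ (2 * n + 1) by rewrite hb //; congr (q ^+ _); lia.
split=> k.
  case: k => [[|k]|k] // _; rewrite (moment_pos hP hF) hFz.
  rewrite (@sum_weight_narayana _ _ _ 1 t q) => [|n|n].
  - by rewrite expr1n mul1r; congr (_ * narayana _ _ _); lia.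
  - by rewrite mul1r.
  by rewrite mul1r.
move=> k_le0; have -> : k = - `|k|%N%:Z by lia.
move: `|k|%N => {k k_le0} k; rewrite abszN normrN absz_nat.
rewrite (moment_neg hP hF) //.
(* F[P_1(z)] = 0 gives F[z] = c_0 F[1], and c_0 = t. *)
have -> : F (zpow K 0) = kappa / t.
  have := biorthogonal_eq0 hF (ltn0Sn 0); rewrite oppr0 (moment_recl0 F hP).
  rewrite !(moment0 F hP) add0r hFz hc muln0 expr0 mulr1 => /eqP.
  by rewrite subr_eq0 => /eqP->; field.
(* Here 1 / c_n = t^(-1) q^(-2n) and b_(n+1) / (c_(n+1) c_n) = t^(-2) q^(-2n-1), hence u = t^(-2), v
   = t and base q^(-1). *)
rewrite (@sum_weight_narayana _ _ _ (t ^- 2) t q^-1) => [|n|n].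
- rewrite !mulrA; congr (_ * _); rewrite -mulrA; congr (_ * _).
  rewrite (_ : -2 * _ - 1 = - (2 * k).+1%:Z); last lia.
  by rewrite exprVn -exprM -invfM -exprS exprnN.
- rewrite bE !hc /= exprVn (_ : 2 * n.+1 = 2 * n + 1 + 1)%N; last lia.
  by rewrite !exprD; field; rewrite ?ht ?hq ?expf_neq0 ?hq.
by rewrite hc exprVn; field; rewrite ?ht ?expf_neq0 ?hq.
Qed.
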